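(* Consider set selection under uncertainty with query costs $c:E\to\mathbb{R}$. Suppose that for an instance $(E,\mathcal{F},\mathcal{I})$ all thresholds $T^+_e,T^-_e$ ($e\in E$) can be computed in time $T_{THR}$, and that a minimum-weight feasible set of $(E,\mathcal{F})$ for given real weights can be computed in time $T_{OPT}$. Then a minimum cost admissible query $Q$ (i.e. an admissible query minimizing $c(Q)=\sum_{e\in Q}c_e$) can be found in time $\mathcal{O}(T_{THR}+|E|)$, and, after the true weights $w_e\in I_e$ of the queried elements are revealed, a universally optimal solution for the intervals $\{\{w_e\}\}_{e\in Q}\cup\{I_e\}_{e\in E\setminus Q}$ can be found in time $\mathcal{O}(T_{OPT}+|E|)$.
   Context: An instance consists of a finite ground set $E$, a nonempty collection $\mathcal{F}\subseteq 2^E$ of feasible sets, and for each $e\in E$ an interval $I_e=[\ell_e,h_e]$; $\mathcal{I}=\{I_e\}_{e\in E}$; $w(S)=\sum_{f\in S}w_f$. A feasible set $S^*$ is universally optimal for a family of intervals if $w(S^* )\le w(S)$ for all $S\in\mathcal{F}$ and all weight vectors $w$ with each $w_f$ in the interval of $f$. A set $Q\subseteq E$ is an admissible query if for every choice of values $w_e\in I_e$ ($e\in Q$), the instance with intervals $\{\{w_e\}\}_{e\in Q}\cup\{I_e\}_{e\in E\setminus Q}$ has a universally optimal solution. For $e\in E$ and $w_{-e}\in\mathbb{R}^{E\setminus\{e\}}$, $\mathrm{OPT}^{-e}(w_{-e})=\min\{w(S)\mid S\in\mathcal{F},e\notin S\}$, $\mathrm{OPT}^{+e}(w_{-e})=\min\{w(S)\mid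 S\in\mathcal{F},e\in S\}$ with $w_e:=0$, and $T_e(w_{-e})=\mathrm{OPT}^{-e}-\mathrm{OPT}^{+e}$ ($+\infty$ if $e$ is in every feasible set, $-\infty$ if in none). The threshold of inclusion $T^+_e$ and of exclusion $T^-_e$ are the infimum and supremum of $T_e(w_{-e})$ over $w_{-e}\in\prod_{f\neq e}I_f$. *)

(* Defs.v *)
From mathcomp Require Import all_boot all_order all_algebra.
From mathcomp Require Import all_classical all_reals ereal.

Set Implicit Arguments.
Unset Strict Implicit.
Unset Printing Implicit Defensive.

Import Order.TTheory GRing.Theory Num.Theory.
Local Open Scope classical_set_scope.
Local Open Scope ring_scope.

Section Uncertainty.
Variables (R : realType) (E : finType) (F : {set {set E}}).
Implicit Types (S Q : {set E}) (w lo hi c : E -> R) (U : E -> set R) (e : E).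

Definition weight w S : R := \sum_(f in S) w f.

Definition intervals lo hi : E -> set R := fun e => [set x | lo e <= x <= hi e].

Definition min_weight w S : Prop :=
  S \in F /\ forall S', S' \in F -> weight w S <= weight w S'.

Definition universally_optimal U S : Prop :=
  S \in F /\
  forall S' w, S' \in F -> (forall f, U f (w f)) -> weight w S <= weight w S'.

Definition reveal Q w U : E -> set R :=
  fun e => if e \in Q then [set w e] else U e.

Definition admissible U Q : Prop :=
  forall w, (forall e, e \in Q -> U e (w e)) ->
  exists S, universally_optimal (reveal Q w U) S.

Definition min_cost_admissible c U Q : Prop :=
  admissible U Q /\
  forall Q', admissible U Q' -> \sum_(e in Q) c e <= \sum_(e in Q') c e.

(* The three functions below do not depend on [w e], so a vector indexed by
   all of [E] stands for a vector indexed by [E] minus [e]. *)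
Definition OPT_excl e w : \bar R :=
  \big[mine/+oo%E]_(S in F | e \notin S) (weight w S)%:E.

Definition OPT_incl e w : \bar R :=
  \big[mine/+oo%E]_(S in F | e \in S)
    (weight (fun f => if f == e then 0 else w f) S)%:E.

(* If [F] is nonempty, [OPT_excl] and [OPT_incl] are not both infinite, so
   this is [+oo] when [e] is in every feasible set and [-oo] when in none. *)
Definition threshold e w : \bar R := (OPT_excl e w - OPT_incl e w)%E.

Definition threshold_values U e : set (\bar R) :=
  [set threshold e w | w in [set w | forall f, f != e -> U f (w f)]].

Definition threshold_incl U e : \bar R := ereal_inf (threshold_values U e).

Definition threshold_excl U e : \bar R := ereal_sup (threshold_values U e).

End Uncertainty.

(* Unit-cost real RAM, presented as a language of structured programs. The
   memory consists of infinite arrays of natural numbers and of reals, named by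
   natural numbers; a program mentions finitely many names, while indices
   within an array are computed (indirect addressing). Real cells support only
   field operations and comparisons; in particular, there is no rounding. *)
Section RealRAM.
Variable R : realType.

Record memory := Memory {
  nmem : nat -> nat -> nat;
  rmem : nat -> nat -> R
}.

Inductive nexp :=
| NLit of nat
| NGet of nat & nexp
| NAdd of nexp & nexp
| NSub of nexp & nexp
| NHalf of nexp.

Inductive rexp :=
| RLit of nat
| RGet of nat & nexp
| RAdd of rexp & rexp
| RSub of rexp & rexp
| RMul of rexp & rexp
| RDiv of rexp & rexp.

Inductive bexp :=
| BNat of nexp & nexp
| BReal of rexp & rexp
| BNot of bexp.

Inductive program :=
| Skip
| NSet of nat & nexp & nexp
| RSet of nat & nexp & rexp
| Seq of program & program
| If of bexp & program & program
| While of bexp & program.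

Fixpoint neval (m : memory) (a : nexp) : nat :=
  match a with
  | NLit k => k
  | NGet x i => nmem m x (neval m i)
  | NAdd a b => (neval m a + neval m b)%N
  | NSub a b => (neval m a - neval m b)%N
  | NHalf a => (neval m a)./2
  end.

Fixpoint reval (m : memory) (a : rexp) : R :=
  match a with
  | RLit k => k%:R
  | RGet x i => rmem m x (neval m i)
  | RAdd a b => reval m a + reval m b
  | RSub a b => reval m a - reval m b
  | RMul a b => reval m a * reval m b
  | RDiv a b => reval m a / reval m b
  end.

Fixpoint beval (m : memory) (b : bexp) : bool :=
  match b with
  | BNat a b => (neval m a < neval m b)%N
  | BReal a b => reval m a < reval m b
  | BNot b => ~~ beval m b
  end.

Fixpoint ncost (a : nexp) : nat :=
  match a with
  | NLit _ => 1
  | NGet _ i => (ncost i).+1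
  | NAdd a b | NSub a b => (ncost a + ncost b).+1
  | NHalf a => (ncost a).+1
  end.

Fixpoint rcost (a : rexp) : nat :=
  match a with
  | RLit _ => 1
  | RGet _ i => (ncost i).+1
  | RAdd a b | RSub a b | RMul a b | RDiv a b => (rcost a + rcost b).+1
  end.

Fixpoint bcost (b : bexp) : nat :=
  match b with
  | BNat a b => (ncost a + ncost b).+1
  | BReal a b => (rcost a + rcost b).+1
  | BNot b => (bcost b).+1
  end.

Definition upd (T : Type) (f : nat -> nat -> T) (x i : nat) (v : T) :=
  fun y j => if (y == x) && (j == i) then v else f y j.

(* [exec P m t m']: started in [m], [P] halts in [m'] after [t] steps. *)
Inductive exec : program -> memory -> nat -> memory -> Prop :=
| ExecSkip m : exec Skip m 1 m
| ExecNSet m x i a :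
    exec (NSet x i a) m (ncost i + ncost a).+1
      (Memory (upd (nmem m) x (neval m i) (neval m a)) (rmem m))
| ExecRSet m x i a :
    exec (RSet x i a) m (ncost i + rcost a).+1
      (Memory (nmem m) (upd (rmem m) x (neval m i) (reval m a)))
| ExecSeq P1 P2 m1 m2 m3 t1 t2 :
    exec P1 m1 t1 m2 -> exec P2 m2 t2 m3 ->
    exec (Seq P1 P2) m1 (t1 + t2) m3
| ExecIf b P1 P2 m m' t :
    exec (if beval m b then P1 else P2) m t m' ->
    exec (If b P1 P2) m (bcost b + t).+1 m'
| ExecWhileEnd b P m :
    ~~ beval m b -> exec (While b P) m (bcost b).+1 m
| ExecWhileStep b P m1 m2 m3 t1 t2 :
    beval m1 b -> exec P m1 t1 m2 -> exec (While b P) m2 t2 m3 ->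
    exec (While b P) m1 (bcost b + t1 + t2).+1 m3.

Definition halts_within (P : program) (m : memory) (T : nat)
    (post : memory -> Prop) : Prop :=
  exists t m', [/\ exec P m t m', (t <= T)%N & post m'].

(* Initial memory: the given finite arrays, named 0, 1, 2 and so on; every
   other cell is zero. *)
Definition load (na : seq (seq nat)) (ra : seq (seq R)) : memory :=
  Memory (fun x => nth 0%N (nth [::] na x)) (fun x => nth 0 (nth [::] ra x)).

Definition outputs_set n (S : {set 'I_n}) (m : memory) : Prop :=
  forall e : 'I_n, nmem m 0 e = (e \in S).

(* An extended real is stored as a tag and a real number. *)
Definition decode (tag : nat) (v : R) : \bar R :=
  match tag with 0 => v%:E | 1 => +oo%E | _ => -oo%E end.

Definition outputs_ereals n (x y : 'I_n -> \bar R) (m : memory) : Prop :=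
  forall e : 'I_n, decode (nmem m 0 e) (rmem m 0 e) = x e /\
                   decode (nmem m 1 e) (rmem m 1 e) = y e.

End RealRAM.

(* A family of set systems together with an arbitrary machine representation:
   the system named [d] has ground set ['I_(size_of d)], and is presented to
   programs by a finite array of naturals and a finite array of reals. *)
Record problem (R : realType) := Problem {
  desc : Type;
  size_of : desc -> nat;
  feasible : forall d, {set {set 'I_(size_of d)}};
  feasible_neq0 : forall d, feasible d != finset.set0;
  nrep : desc -> seq nat;
  rrep : desc -> seq R
}.

Record instance (R : realType) (p : problem R) := Instance {
  system : desc p;
  lower : 'I_(size_of system) -> R;
  upper : 'I_(size_of system) -> R;
  lower_le_upper : forall e, lower e <= upper e
}.

Arguments lower {R p} i e.
Arguments upper {R p} i e.

Section Computability.
Variables (R : realType) (p : problem R).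
Implicit Types (d : desc p) (I : instance p).

Definition card_of I : nat := size_of (system I).

Definition ground_intervals I := intervals (lower I) (upper I).
Arguments ground_intervals : clear implicits.

Definition optimization_input d (w : 'I_(size_of d) -> R) : memory R :=
  load [:: nrep d; [:: size_of d]] [:: rrep d; codom w].

Definition threshold_input I : memory R :=
  load [:: nrep (system I); [:: card_of I]]
       [:: rrep (system I); codom (lower I); codom (upper I)].

Definition query_input I (c : 'I_(card_of I) -> R) : memory R :=
  load [:: nrep (system I); [:: card_of I]]
       [:: rrep (system I); codom (lower I); codom (upper I);
           codom c].

(* The true weights of the elements outside of [Q] are masked. *)
Definition solution_input I (Q : {set 'I_(card_of I)})
    (w : 'I_(card_of I) -> R) : memory R :=
  load [:: nrep (system I); [:: card_of I];
           codom (fun e => nat_of_bool (e \in Q))]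
       [:: rrep (system I); codom (lower I); codom (upper I);
           codom (fun e => if e \in Q then w e else 0)].

(* One program handles all instances of the class [K]; time bounds may vary
   with the instance. *)
Definition thresholds_computable_in (K : set (instance p))
    (T : instance p -> nat) : Prop :=
  exists P, forall I, K I ->
    halts_within P (threshold_input I) (T I)
      (outputs_ereals
         (threshold_incl (feasible (system I)) (ground_intervals I))
         (threshold_excl (feasible (system I)) (ground_intervals I))).

Definition optimization_computable_in (K : set (instance p))
    (T : desc p -> nat) : Prop :=
  exists P, forall I, K I -> forall w : 'I_(card_of I) -> R,
    exists S, min_weight (feasible (system I)) w S /\
      halts_within P (optimization_input w) (T (system I)) (outputs_set S).

End Computability.

Arguments ground_intervals {R p} I _ _.

(* Main.v *)
(* An element e must be queried exactly when T_e takes a value in the open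
   interval from l_e to h_e, that is, when l_e < h_e, T+_e < h_e and
   l_e < T-_e: some weights of the other elements then make e belong to every
   optimum for w_e = l_e and to no optimum for w_e = h_e. Conversely, every set
   containing these elements is admissible: for weights in the interior of the
   unqueried intervals, all optima contain the same unqueried elements, so an
   optimum for the midpoints is universally optimal. A cheapest admissible query
   thus adds to the mandatory elements those of negative cost. On the machine,
   the given programs run with their arrays renamed, so that the data needed
   after or beside them are preserved. *)

Require Import Defs.
From mathcomp Require Import all_boot all_order all_algebra.
From mathcomp Require Import all_classical all_reals ereal.
From mathcomp Require Import zify ring lra.

Set Implicit Arguments.
Unset Strict Implicit.
Unset Printing Implicit Defensive.

Import Order.TTheory GRing.Theory Num.Theory.
Local Open Scope classical_set_scope.
Local Open Scope ring_scope.

(** * Thresholds and admissible queries *)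

Section Thresholds.
Variables (R : realType) (E : finType) (F : {set {set E}}).
Hypothesis F_neq0 : F != finset.set0.
Implicit Types (S Q : {set E}) (w v c : E -> R) (e : E).

(** * Optimal feasible sets and the threshold of an element *)

Lemma weightE w S : weight w S = \sum_f (if f \in S then w f else 0).
Proof. by rewrite /weight big_mkcond. Qed.

Lemma min_weight_exists w : exists S, min_weight F w S.
Proof.
have [S0 FS0] := set0Pn F F_neq0.
have [S FS Smin] := @arg_minP _ R _ S0 (mem F) (weight w) FS0.
by exists S; split.
Qed.

Lemma bigmin_EFin (I : finType) (P : pred I) (g : I -> R) :
  P =1 xpred0 /\ \big[mine/+oo%E]_(i | P i) (g i)%:E = +oo%E \/
  exists i, [/\ P i, \big[mine/+oo%E]_(i | P i) (g i)%:E = (g i)%:E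
              & forall j, P j -> g i <= g j].
Proof.
have [i0 Pi0|P0] := pickP P; last by left; split; rewrite ?big_pred0.
have [i Pi imin] := @arg_minP _ R _ i0 P g Pi0.
right; exists i; split=> //; apply/le_anti/andP; split.
  exact: (bigmin_le_cond _ (fun j => (g j)%:E)).
by apply/bigmin_geP; split=> [|j Pj]; rewrite ?leey ?lee_fin ?imin.
Qed.

Definition excluding e : pred {set E} := fun S => (S \in F) && (e \notin S).
Definition including e : pred {set E} := fun S => (S \in F) && (e \in S).
Definition setw w e (x : R) : E -> R := fun f => if f == e then x else w f.

Lemma excl_or_incl e S : S \in F -> excluding e S || including e S.
Proof. by rewrite /excluding /including => ->; case: (e \in S). Qed.

Lemma weight_setw w e x S :
  weight (setw w e x) S = weight (setw w e 0) S + (if e \in S then x else 0).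
Proof.
rewrite !weightE (bigD1 e) //= [in RHS](bigD1 e) //= /setw eqxx if_same add0r.
by rewrite addrC; congr (_ + _); apply: eq_bigr => f /negPf ->.
Qed.

Lemma setw_id w e : setw w e (w e) = w.
Proof. by apply/funext => f; rewrite /setw; case: eqP => [->|]. Qed.

Lemma weight_excluding w e S : e \notin S -> weight w S = weight (setw w e 0) S.
Proof. by move=> eS; rewrite -{1}(setw_id w e) weight_setw (negPf eS) addr0. Qed.

Lemma weight_including w e S :
  e \in S -> weight w S = weight (setw w e 0) S + w e.
Proof. by move=> eS; rewrite -{1}(setw_id w e) weight_setw eS. Qed.

(** Each minimum is attained unless it has no candidate, and since [F] is nonempty, at least one of
    the two has candidates. [S2] is optimal for the weights with entry 0 at [e], as in
    [OPT_incl]. *)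
Lemma thresholdP e w :
  [\/ excluding e =1 xpred0 /\ threshold F e w = +oo%E,
      including e =1 xpred0 /\ threshold F e w = -oo%E
    | exists S1 S2, [/\ excluding e S1, including e S2,
        threshold F e w = (weight w S1 - weight (setw w e 0) S2)%:E,
        forall S, excluding e S -> weight w S1 <= weight w S
      & forall S, including e S ->
          weight (setw w e 0) S2 <= weight (setw w e 0) S]].
Proof.
rewrite /threshold /OPT_excl /OPT_incl.
have [[e0 ->]|[S1 [S1e -> S1min]]] := bigmin_EFin (excluding e) (weight w);
  have [[i0 ->]|[S2 [S2e -> S2min]]] :=
    bigmin_EFin (including e) (weight (setw w e 0)).
- have [S FS] := set0Pn F F_neq0.
  by have := excl_or_incl e FS; rewrite e0 i0.
- by constructor 1.
- by constructor 2.
- by constructor 3; exists S1, S2; split; rewrite ?EFinB.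
Qed.

Lemma threshold_setw e w x : threshold F e (setw w e x) = threshold F e w.
Proof.
rewrite /threshold; congr (_ - _)%E; apply: eq_bigr => S /andP[_ eS].
  rewrite [in LHS](weight_excluding _ eS) [in RHS](weight_excluding _ eS).
  congr (weight _ _)%:E.
  by apply/funext => f; rewrite /setw; case: eqP.
by congr (weight _ _)%:E; apply/funext => f; rewrite /setw; case: eqP.
Qed.

(** An optimum avoiding [e] would weigh at least as much as [S1] and at most as much as [S2], so the
    threshold would be at most [w e]. *)
Lemma lt_threshold e w S :
  ((w e)%:E < threshold F e w)%E -> min_weight F w S -> e \in S.
Proof.
move=> wlt [FS Smin]; case: (boolP (e \in S)) => // eS.
have Se : excluding e S by rewrite /excluding FS eS.
case: (thresholdP e w) wlt => [[e0 _]|[_ ->]|[S1 [S2 [S1e S2e -> S1min _]]]].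
- by rewrite e0 in Se.
- by rewrite ltNge leNye.
have [FS2 eS2] := andP S2e.
rewrite lte_fin => wlt; have := S1min _ Se; have := Smin _ FS2.
rewrite (weight_including _ eS2); lra.
Qed.

Lemma gt_threshold e w S :
  (threshold F e w < (w e)%:E)%E -> min_weight F w S -> e \notin S.
Proof.
move=> wlt [FS Smin]; case: (boolP (e \in S)) => // eS.
have Se : including e S by rewrite /including FS eS.
case: (thresholdP e w) wlt => [[_ ->]|[i0 _]|[S1 [S2 [S1e S2e -> _ S2min]]]].
- by rewrite ltNge leey.
- by rewrite i0 in Se.
have [FS1 eS1] := andP S1e.
rewrite lte_fin => wlt; have := S2min _ Se; have := Smin _ FS1.
rewrite (weight_including _ eS); lra.
Qed.

(** * Continuity of the threshold *)

Lemma weight_lipschitz w v S : weight w S <= weight v S + \sum_f `|w f - v f|.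
Proof.
rewrite !weightE -big_split /=; apply: ler_sum => f _.
case: ifP => _; last by rewrite add0r.
by have := ler_norm (w f - v f); lra.
Qed.

(** The factor 2 comes from the two optimal values, each 1-Lipschitz in the sum norm. Whether a
    threshold is infinite depends on [F] and [e] alone. *)
Lemma threshold_lipschitz e w v :
  (threshold F e w <= threshold F e v + ((\sum_f `|w f - v f|) *+ 2)%:E)%E.
Proof.
case: (thresholdP e v) => [[e0 ->]|[i0 ->]|[S1 [S2 [S1e S2e -> _ S2min]]]].
- by rewrite addye ?leey.
- case: (thresholdP e w) => [[e0 _]|[_ ->]|[S1 [S2 [_ S2e]]]].
  + have [S FS] := set0Pn F F_neq0.
    by have := excl_or_incl e FS; rewrite e0 i0.
  + by rewrite leNye.
  + by rewrite i0 in S2e.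
case: (thresholdP e w) => [[e0 _]|[_ ->]|[S3 [S4 [S3e S4e -> S3min _]]]].
- by rewrite e0 in S1e.
- by rewrite leNye.
rewrite -EFinD lee_fin mulr2n.
(* [S1] is best for [v] and a mere candidate for [w]; for [S4] it is the other way round. *)
have := S3min _ S1e; have := S2min _ S4e; have := weight_lipschitz w v S1.
have := weight_lipschitz (setw v e 0) (setw w e 0) S4.
have : \sum_f `|setw v e 0 f - setw w e 0 f| <= \sum_f `|w f - v f|.
  apply: ler_sum => f _; rewrite /setw; case: eqP => _.
    by rewrite subrr normr0.
  by rewrite distrC.
lra.
Qed.

(* Replaces the intermediate value theorem: a step of length [d < b - a] cannot
   jump over the interval from [a] to [b]. *)
Lemma small_steps (u : nat -> \bar R) (a b d : R) (N : nat) :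
  (u 0%N < b%:E)%E -> (a%:E < u N)%E -> d < b - a ->
  (forall i, u i.+1 <= u i + d%:E)%E ->
  exists i, (i <= N)%N /\ (a%:E < u i < b%:E)%E.
Proof.
move=> u0 uN db ustep; apply: contrapT => no.
have low i : (i <= N)%N -> (u i < b%:E)%E -> (u i <= a%:E)%E.
  by move=> iN ub; rewrite leNgt; apply/negP => au; apply: no; exists i; rewrite au.
suff : (u N <= a%:E)%E by rewrite leNgt uN.
(* Induction over all indices up to [N]: a step from a value at most [a] ends below [b], hence again
   at most [a]. *)
have : (N <= N)%N by [].
elim: {-2}N => [|i IH] iN; first exact: low.
apply: low => //; apply: le_lt_trans (ustep i) _.
apply: (@le_lt_trans _ _ (a%:E + d%:E)%E); first by rewrite leeD2r ?IH // ltnW.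
by rewrite -EFinD lte_fin; lra.
Qed.

(** * Mandatory elements and cheapest admissible queries *)

Variables lo hi : E -> R.
Hypothesis lo_le_hi : forall e, lo e <= hi e.
Let U := intervals lo hi.

Definition mandatory e : bool :=
  [&& lo e < hi e, (threshold_incl F U e < (hi e)%:E)%E
    & ((lo e)%:E < threshold_excl F U e)%E].

(** The infimum and supremum provide one point with threshold below [hi e] and one with threshold
    above [lo e]. Along a fine subdivision of the segment joining them, some threshold lies strictly
    between; the segment stays in the box by convexity. *)
Lemma threshold_between e : mandatory e ->
  exists2 w, forall f, f != e -> U f (w f)
           & ((lo e)%:E < threshold F e w < (hi e)%:E)%E.
Proof.
case/and3P => lh /ereal_inf_lt[_ [w1 w1U <-] w1h].
move=> /ereal_sup_gt[_ [w2 w2U <-] w2l].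
pose D := (\sum_f `|w2 f - w1 f|) *+ 2.
have lh0 : 0 < hi e - lo e by lra.
(* With this many steps, the Lipschitz bound [D / N] of a single step is less than [hi e - lo e]. *)
pose N := (Num.truncn (D / (hi e - lo e))).+1.
have N0 : 0 < N%:R :> R by rewrite ltr0n.
pose v i := fun f => w1 f + i%:R / N%:R * (w2 f - w1 f).
have v0 : v 0%N = w1 by apply/funext => f; rewrite /v mul0r mul0r addr0.
have vN : v N = w2.
  by apply/funext => f; rewrite /v divff ?gt_eqF // mul1r addrC subrK.
have [|||i|i [iN vi]] :=
  @small_steps (fun i => threshold F e (v i)) (lo e) (hi e) (D / N%:R) N.
- by rewrite v0.
- by rewrite vN.
- rewrite ltr_pdivrMr // mulrC -ltr_pdivrMr //; exact: truncnS_gt.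
- apply: le_trans (threshold_lipschitz e (v i.+1) (v i)) _.
  rewrite leeD2l // lee_fin le_eqVlt; apply/orP; left; apply/eqP.
  rewrite /D mulrnAl mulr_suml; congr (_ *+ 2); apply: eq_bigr => f _.
  have -> : v i.+1 f - v i f = (w2 f - w1 f) / N%:R.
    by rewrite /v -[in i.+1%:R]addn1 natrD; ring.
  by rewrite normrM (gtr0_norm (x := N%:R^-1)) ?invr_gt0.
exists (v i) => // f fe; rewrite /U /intervals /= /v.
have /andP[a1 b1] := w1U f fe; have /andP[a2 b2] := w2U f fe.
have t0 : 0 <= i%:R / N%:R :> R by rewrite divr_ge0.
have t1 : i%:R / N%:R <= 1 :> R by rewrite ler_pdivrMr // mul1r ler_nat.
by apply/andP; split; nra.
Qed.

(** If [e] were unqueried, a single [S] would be optimal for [w] with entry [lo e] and with entry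
    [hi e] at [e]. A threshold strictly between the two forces [e] into [S] in the first case and
    out of it in the second. *)
Lemma mandatory_admissible Q e : admissible F U Q -> mandatory e -> e \in Q.
Proof.
move=> admQ /threshold_between[w wU /andP[lw wh]].
apply/negPn/negP => eQ.
have [|S [FS Sopt]] := admQ w.
  by move=> f fQ; apply: wU; apply: contraNneq eQ => <-.
have Smin x : U e x -> min_weight F (setw w e x) S.
  move=> Ux; split=> // S' FS'; apply: Sopt => // f; rewrite /reveal /setw.
  have [->|fe] := eqVneq f e; first by rewrite (negPf eQ).
  by case: ifP => // _; apply: wU.
have := @gt_threshold e (setw w e (hi e)) S.
have := @lt_threshold e (setw w e (lo e)) S.
rewrite !threshold_setw /setw eqxx => /(_ lw) in_ /(_ wh) out.
have Ulo : U e (lo e) by rewrite /U /intervals /= lexx lo_le_hi.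
have Uhi : U e (hi e) by rewrite /U /intervals /= lexx lo_le_hi.
by have := out (Smin _ Uhi); rewrite in_ //; apply: Smin.
Qed.

Definition midpoint Q w : E -> R :=
  fun f => if f \in Q then w f else (lo f + hi f) / 2.

(** As [lo e < hi e], either all thresholds are at least [hi e], or all are at most [lo e]. In both
    cases [v e] is strictly on one side, and the side does not depend on [v]. *)
Lemma not_mandatory_mem e v S : ~~ mandatory e -> (forall f, U f (v f)) ->
  lo e < v e < hi e -> min_weight F v S ->
  (e \in S) = ((hi e)%:E <= threshold_incl F U e)%E.
Proof.
move=> nM vU /andP[lv vh] vS.
have Tv : threshold_values F U e (threshold F e v) by exists v.
case: leP => [hT|Th].
  apply: (lt_threshold _ vS); apply: lt_le_trans (ereal_inf_lbound Tv).
  by apply: lt_le_trans hT; rewrite lte_fin.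
apply/negbTE; apply: (gt_threshold _ vS).
move: nM; rewrite /mandatory (lt_trans lv vh) Th /= -leNgt => Tl.
apply: le_lt_trans (ereal_sup_ubound Tv) _.
by apply: le_lt_trans Tl _; rewrite lte_fin.
Qed.

(* Every optimum of weights strictly inside the unqueried intervals contains
   the same unqueried elements, so the midpoint optimum is optimal for the
   perturbation [(1 - t) v + t m] of any realization [v]; let [t] tend to 0. *)
Lemma midpoint_universally_optimal Q w S :
  (forall e, mandatory e -> e \in Q) -> (forall e, e \in Q -> U e (w e)) ->
  min_weight F (midpoint Q w) S -> universally_optimal F (reveal Q w U) S.
Proof.
move=> MQ wU mS; split=> [|S' v FS' vU]; first by case: mS.
set m := midpoint Q w in mS *.
have vU' f : U f (v f).
  by have := vU f; rewrite /reveal; case: ifP => // fQ ->; apply: wU.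
have mU f : U f (m f).
  rewrite /m /midpoint; case: ifPn => [/wU //|_].
  by rewrite /U /intervals /=; have := lo_le_hi f; lra.
have vtS t : 0 < t -> t <= 1 ->
    (1 - t) * weight v S + t * weight m S <=
    (1 - t) * weight v S' + t * weight m S'.
  move=> t0 t1; pose vt f := (1 - t) * v f + t * m f.
  have vtE S1 : weight vt S1 = (1 - t) * weight v S1 + t * weight m S1.
    by rewrite /weight /vt big_split /= -!mulr_sumr.
  have vtU f : U f (vt f).
    move: (vU' f) (mU f); rewrite /U /intervals /= /vt => /andP[? ?] /andP[? ?].
    by apply/andP; split; nra.
  have [T Tmin] := min_weight_exists vt.
  rewrite -!vtE; apply: le_trans (_ : weight vt T <= _); last by case: Tmin => _; apply.
  (* Wherever [vt] and [m] differ, [S] and [T] agree, so the two weightings give the same difference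
     between [S] and [T]; [S] is no heavier than [T] under [m]. *)
  suff : weight vt S + weight m T = weight vt T + weight m S.
    by case: mS => _ /(_ T (proj1 Tmin)); lra.
  rewrite !weightE -!big_split /=; apply: eq_bigr => f _.
  have [fQ|fQ] := boolP (f \in Q).
    have -> : vt f = m f.
      by move: (vU f); rewrite /vt /reveal /m /midpoint fQ /= => ->; lra.
    by rewrite addrC.
  have := lo_le_hi f; rewrite le_eqVlt => /orP[/eqP lh|lh].
    have -> : vt f = m f.
      have /andP[? ?] := vtU f; have /andP[? ?] := mU f; lra.
    by rewrite addrC.
  have nM : ~~ mandatory f by apply: contra fQ => /MQ.
  have mf : lo f < m f < hi f by rewrite /m /midpoint (negPf fQ); lra.
  have vtf : lo f < vt f < hi f.
    rewrite /vt; move: mf (vU' f); rewrite /U /intervals /= => /andP[? ?] /andP[? ?].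
    by apply/andP; split; nra.
  by rewrite (not_mandatory_mem nM mU mf mS) (not_mandatory_mem nM vtU vtf Tmin).
rewrite leNgt; apply/negP => lt.
have := vtS 1 ltr01 (lexx 1).
pose a := weight v S - weight v S'; pose b := weight m S' - weight m S.
rewrite subrr !mul0r !add0r !mul1r => b0.
have a0 : 0 < a by rewrite subr_gt0.
have {}b0 : 0 <= b by rewrite subr_ge0.
have ab : 0 < (a + b) * 2 by lra.
(* The inequality [vtS] reads [a <= t * (a + b)]; this [t] makes the right side [a / 2],
   contradicting [0 < a]. *)
set t := a / ((a + b) * 2).
have tab : t * ((a + b) * 2) = a by rewrite /t divfK ?gt_eqF.
have t0 : 0 < t by rewrite divr_gt0.
have t1 : t <= 1 by rewrite ler_pdivrMr // mul1r; lra.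
by have := vtS t t0 t1; move: tab; rewrite /a /b in a0 *; lra.
Qed.

Definition optimal_query c : {set E} := [set e | (c e < 0) || mandatory e].

Lemma optimal_query_min_cost c : min_cost_admissible F c U (optimal_query c).
Proof.
split=> [w wU|Q admQ].
  have [S mS] := min_weight_exists (midpoint (optimal_query c) w).
  exists S; apply: midpoint_universally_optimal => // e Me.
  by rewrite inE Me orbT.
(* Termwise comparison: mandatory elements occur in both sums, and any other one contributes the
   minimum of [c e] and 0 on the left. *)
rewrite big_mkcond [leRHS]big_mkcond; apply: ler_sum => e _; rewrite inE.
have [/(mandatory_admissible admQ) ->|_] := boolP (mandatory e).
  by rewrite orbT.
by rewrite orbF; case: ltP; case: ifP => // _; apply: ltW.
Qed.

End Thresholds.

(** * Programs *)

Section Programs.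
Variable R : realType.
Implicit Types (m : memory R) (P : program).

(** * Running loop-free programs and counting loops *)

Lemma exec_gt0 P m t m' : exec P m t m' -> (0 < t)%N.
Proof. by elim=> //; lia. Qed.

(** Lets a multiple of [T] absorb additive constants, even for an empty ground set. *)
Lemma halts_within_gt0 P m T post : halts_within P m T post -> (0 < T)%N.
Proof. by case=> t [m' [/exec_gt0 t0 tT _]]; apply: leq_trans tT. Qed.

Lemma halts_within_le P m T1 T2 (post1 post2 : memory R -> Prop) :
  halts_within P m T1 post1 -> (T1 <= T2)%N ->
  (forall m', post1 m' -> post2 m') -> halts_within P m T2 post2.
Proof.
move=> [t [m' [Pm tT pm]]] T12 post; exists t, m'.
by split; [|apply: leq_trans T12|apply: post].
Qed.

Lemma halts_within_Seq P1 P2 m T1 T2 (post1 post2 : memory R -> Prop) :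
  halts_within P1 m T1 post1 ->
  (forall m', post1 m' -> halts_within P2 m' T2 post2) ->
  halts_within (Seq P1 P2) m (T1 + T2) post2.
Proof.
move=> [t1 [m1 [e1 tT1 p1]]] /(_ _ p1)[t2 [m2 [e2 tT2 p2]]].
by exists (t1 + t2)%N, m2; split; [apply: ExecSeq e1 e2|apply: leq_add|].
Qed.

Fixpoint loop_free P : bool :=
  match P with
  | Skip | NSet _ _ _ | RSet _ _ _ => true
  | Seq P1 P2 | If _ P1 P2 => loop_free P1 && loop_free P2
  | While _ _ => false
  end.

(** A functional semantics, so that bodies of loops can be evaluated by computation; the value at
    [While] is a dummy, excluded by [loop_free]. *)
Fixpoint run P m : memory R :=
  match P with
  | NSet x i a =>
    Memory (upd (nmem m) x (neval m i) (neval m a)) (rmem m)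
  | RSet x i a =>
    Memory (nmem m) (upd (rmem m) x (neval m i) (reval m a))
  | Seq P1 P2 => run P2 (run P1 m)
  | If b P1 P2 => if beval m b then run P1 m else run P2 m
  | Skip | While _ _ => m
  end.

Fixpoint cost_bound P : nat :=
  match P with
  | Skip | While _ _ => 1
  | NSet _ i a => (ncost i + ncost a).+1
  | RSet _ i a => (ncost i + rcost a).+1
  | Seq P1 P2 => cost_bound P1 + cost_bound P2
  | If b P1 P2 => (bcost b + maxn (cost_bound P1) (cost_bound P2)).+1
  end.

Lemma run_If b P Q m :
  run (If b P Q) m = if beval m b then run P m else run Q m.
Proof. by []. Qed.

Lemma halts_within_run P m (post : memory R -> Prop) :
  loop_free P -> post (run P m) -> halts_within P m (cost_bound P) post.
Proof.
move=> lf pm.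
suff [t eP tP] : exists2 t, exec P m t (run P m) & (t <= cost_bound P)%N.
  by exists t, (run P m).
elim: P m lf {pm} => [|x i a|x i a|P1 IH1 P2 IH2|b P1 IH1 P2 IH2|//] m //=.
- by exists 1%N => //; constructor.
- by exists (ncost i + ncost a).+1 => //; constructor.
- by exists (ncost i + rcost a).+1 => //; constructor.
- case/andP=> /(IH1 m)[t1 e1 tT1] /(IH2 (run P1 m))[t2 e2 tT2].
  by exists (t1 + t2)%N; [apply: ExecSeq e1 e2|apply: leq_add].
case/andP=> /(IH1 m)[t1 e1 tT1] /(IH2 m)[t2 e2 tT2].
case bm: (beval m b); [exists (bcost b + t1).+1|exists (bcost b + t2).+1];
  by [constructor; rewrite bm|rewrite ltnS leq_add2l leq_max ?tT1 ?tT2 ?orbT].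
Qed.

(* Cell 0 of the naturals array 3 is the loop counter, cell 1 its bound. *)
Definition counter := NGet 3 (NLit 0).
Definition bound := NGet 3 (NLit 1).

Definition increment := NSet 3 (NLit 0) (NAdd counter (NLit 1)).

Definition For (a : nexp) (body : program) : program :=
  Seq (Seq (NSet 3 (NLit 1) a) (NSet 3 (NLit 0) (NLit 0)))
      (While (BNat counter bound) (Seq body increment)).

Definition agree_off_control m m' : Prop :=
  (forall x j, x != 3%N -> nmem m' x j = nmem m x j) /\ rmem m' = rmem m.

(** A round costs the body, 6 for the increment and 6 for the test; the final 11 covers
    initialization and the last, failing test. The invariant must ignore the control array. The
    bound cell is kept in the conclusion because a later loop takes [n] from it. *)
Lemma halts_within_For a body m n (inv : nat -> memory R -> Prop) :
  loop_free body -> neval m a = n ->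
  (forall i m1 m2, agree_off_control m1 m2 -> inv i m1 -> inv i m2) ->
  inv 0%N m ->
  (forall i m', (i < n)%N -> nmem m' 3 0 = i -> inv i m' ->
     inv i.+1 (run body m') /\ nmem (run body m') 3 = nmem m' 3) ->
  halts_within (For a body) m ((cost_bound body + 12) * n + ncost a + 11)
    (fun m' => inv n m' /\ nmem m' 3 1 = n).
Proof.
move=> lf an stable inv0 step.
pose ready i m' := [/\ inv i m', nmem m' 3 0 = i & nmem m' 3 1 = n].
have loop k i m' : (i + k)%N = n -> ready i m' ->
    halts_within (While (BNat counter bound) (Seq body increment)) m'
      ((cost_bound body + 12) * k + 6)
      (fun m' => inv n m' /\ nmem m' 3 1 = n).
  elim: k i m' => [|k IH] i m' ikn [invi ci bi].
    exists 6%N, m'; split; first by apply: ExecWhileEnd; rewrite /= ci bi; lia.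
      by lia.
    by rewrite -ikn addn0 in bi *.
  have iltn : (i < n)%N by lia.
  have [invS body3] := step i m' iltn ci invi.
  have [t1 [m1 [e1 tT1 ready1]]] :
      halts_within (Seq body increment) m' (cost_bound (Seq body increment))
        (ready i.+1).
    apply: halts_within_run; first by rewrite /= lf.
    split; last 2 first.
    - by rewrite /= /upd /= body3 ci addn1.
    - by rewrite /= /upd /= body3.
    apply: stable invS; split=> // x j x3.
    by rewrite /= /upd (negPf x3).
  have [|t2 [m2 [e2 tT2 p2]]] := IH i.+1 m1 _ ready1; first by lia.
  exists (bcost (BNat counter bound) + t1 + t2).+1, m2; split=> //.
    by apply: ExecWhileStep e1 e2; rewrite /= ci bi.
  by move: tT1 => /=; lia.
apply: halts_within_le
  (halts_within_Seq (T2 := (cost_bound body + 12) * n + 6)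
     (@halts_within_run _ _ (ready 0%N) _ _) (loop n 0%N ^~ _)) _ _ => //.
- split; rewrite /= /upd //=.
  by apply: stable inv0; split=> // x j x3; rewrite /= /upd (negPf x3).
- by move=> /=; lia.
Qed.

(** * Simulation of a program on renamed arrays *)

Section Renaming.
Variables s r : nat -> nat.
Hypotheses (s_inj : injective s) (r_inj : injective r).

Fixpoint nrename (a : nexp) : nexp :=
  match a with
  | NLit k => NLit k
  | NGet x i => NGet (s x) (nrename i)
  | NAdd a b => NAdd (nrename a) (nrename b)
  | NSub a b => NSub (nrename a) (nrename b)
  | NHalf a => NHalf (nrename a)
  end.

Fixpoint rrename (a : rexp) : rexp :=
  match a with
  | RLit k => RLit k
  | RGet x i => RGet (r x) (nrename i)
  | RAdd a b => RAdd (rrename a) (rrename b)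
  | RSub a b => RSub (rrename a) (rrename b)
  | RMul a b => RMul (rrename a) (rrename b)
  | RDiv a b => RDiv (rrename a) (rrename b)
  end.

Fixpoint brename (b : bexp) : bexp :=
  match b with
  | BNat a b => BNat (nrename a) (nrename b)
  | BReal a b => BReal (rrename a) (rrename b)
  | BNot b => BNot (brename b)
  end.

Fixpoint rename P : program :=
  match P with
  | Skip => Skip
  | NSet x i a => NSet (s x) (nrename i) (nrename a)
  | RSet x i a => RSet (r x) (nrename i) (rrename a)
  | Seq P1 P2 => Seq (rename P1) (rename P2)
  | If b P1 P2 => If (brename b) (rename P1) (rename P2)
  | While b P => While (brename b) (rename P)
  end.

Definition represents m m' : Prop :=
  (forall x, nmem m' (s x) =1 nmem m x) /\
  (forall x, rmem m' (r x) =1 rmem m x).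

Definition agree_off_image m m' : Prop :=
  (forall x, (forall y, x <> s y) -> nmem m' x =1 nmem m x) /\
  (forall x, (forall y, x <> r y) -> rmem m' x =1 rmem m x).

Lemma neval_rename m m' a : represents m m' -> neval m' (nrename a) = neval m a.
Proof. by case=> mn _; elim: a => /= [//|x i ->|a -> b ->|a -> b ->|a ->]; rewrite ?mn. Qed.

Lemma reval_rename m m' a : represents m m' -> reval m' (rrename a) = reval m a.
Proof.
move=> mm'; elim: a => /= [//|x i|a -> b ->|a -> b ->|a -> b ->|a -> b ->] //.
by rewrite (neval_rename _ mm') (proj2 mm').
Qed.

Lemma beval_rename m m' b : represents m m' -> beval m' (brename b) = beval m b.
Proof.
move=> mm'; elim: b => /= [a b|a b|b -> //].
  by rewrite !(neval_rename _ mm').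
by rewrite !(reval_rename _ mm').
Qed.

Lemma ncost_rename a : ncost (nrename a) = ncost a.
Proof.
by elim: a => /= [//|x i ->|a -> b ->|a -> b ->|a ->].
Qed.

Lemma rcost_rename a : rcost (rrename a) = rcost a.
Proof.
elim: a => /= [//|x i|a -> b ->|a -> b ->|a -> b ->|a -> b ->] //.
by rewrite ncost_rename.
Qed.

Lemma bcost_rename b : bcost (brename b) = bcost b.
Proof.
by elim: b => /= [a b|a b|b ->]; rewrite ?ncost_rename ?rcost_rename.
Qed.

Lemma agree_off_image_trans m1 m2 m3 :
  agree_off_image m1 m2 -> agree_off_image m2 m3 -> agree_off_image m1 m3.
Proof.
move=> [n12 r12] [n23 r23].
by split=> x xP j; rewrite ?n23 ?n12 ?r23 ?r12.
Qed.

(** By injectivity, a write to a renamed array affects the image of that array only. Array names are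
    static and indices are untouched, so the simulation is step by step with equal cost. *)
Lemma exec_rename P m t m2 : exec P m t m2 ->
  forall m', represents m m' ->
  exists m2', [/\ exec (rename P) m' t m2', represents m2 m2'
                & agree_off_image m' m2'].
Proof.
elim=> {P m t m2}.
- by move=> m m' mm'; exists m'; split=> //; constructor.
- move=> m x i a m' mm'.
  exists (run (NSet (s x) (nrename i) (nrename a)) m'); split.
  + rewrite -{1}(ncost_rename i) -{1}(ncost_rename a); constructor.
  + split=> y j /=; last by rewrite (proj2 mm').
    rewrite /upd !(neval_rename _ mm') (inj_eq s_inj).
    by case: ifP => // _; rewrite (proj1 mm').
  + split=> y yP j //=; rewrite /upd.
    by case: eqP => // yx; case: (yP x).
- move=> m x i a m' mm'.
  exists (run (RSet (r x) (nrename i) (rrename a)) m'); split.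
  + rewrite -{1}(ncost_rename i) -{1}(rcost_rename a); constructor.
  + split=> y j /=; first by rewrite (proj1 mm').
    rewrite /upd !(neval_rename _ mm') (reval_rename _ mm') (inj_eq r_inj).
    by case: ifP => // _; rewrite (proj2 mm').
  + split=> y yP j //=; rewrite /upd.
    by case: eqP => // yx; case: (yP x).
- move=> P1 P2 m1 m2 m3 t1 t2 _ IH1 _ IH2 m1' /IH1[m2' [e1 m22' a1]].
  have [m3' [e2 m33' a2]] := IH2 _ m22'; exists m3'.
  by split=> //; [apply: ExecSeq e1 e2|apply: agree_off_image_trans a1 a2].
- move=> b P1 P2 m m2 t _ IH m' mm'; have [m2' [e m22' a]] := IH _ mm'.
  exists m2'; split=> //=; rewrite -(bcost_rename b); constructor.
  by rewrite (beval_rename _ mm'); case: (beval m b) e.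
- move=> b P m bm m' mm'; exists m'; split=> //=.
  by rewrite -(bcost_rename b); constructor; rewrite (beval_rename _ mm').
move=> b P m1 m2 m3 t1 t2 bm _ IH1 _ IH2 m1' mm'.
have [m2' [e1 m22' a1]] := IH1 _ mm'; have [m3' [e2 m33' a2]] := IH2 _ m22'.
exists m3'; split=> //=; last exact: agree_off_image_trans a1 a2.
rewrite -(bcost_rename b); apply: ExecWhileStep e1 e2.
by rewrite (beval_rename _ mm').
Qed.

Lemma halts_within_rename P m m' T post :
  represents m m' -> halts_within P m T post ->
  halts_within (rename P) m' T
    (fun m2' => agree_off_image m' m2' /\ exists2 m2, represents m2 m2' & post m2).
Proof.
move=> mm' [t [m2 [e tT pm2]]]; have [m2' [e' m22' a]] := exec_rename e mm'.
by exists t, m2'; split=> //; split=> //; exists m2.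
Qed.

End Renaming.

(* Array names in the interval from [k] to [k + d - 1] are kept out of reach of
   the renamed program; the names below [k], holding its input, stay in place,
   as copying the description of the set system could take too long. *)
Definition shift k d x : nat := if (x < k)%N then x else (x + d)%N.

Lemma shift_inj k d : injective (shift k d).
Proof. by move=> x y; rewrite /shift; case: ltnP => ?; case: ltnP => ? ?; lia. Qed.

Lemma shift_reserved k d x : (k <= x < k + d)%N -> forall y, x <> shift k d y.
Proof. by move=> kxd y; rewrite /shift; case: ltnP => ?; lia. Qed.

(** * Loops to run before and after the given programs *)

Definition save_intervals : program :=
  For (NGet 1 (NLit 0))
    (Seq (RSet 4 counter (RGet 1 counter)) (RSet 5 counter (RGet 2 counter))).

(** The threshold program may overwrite its inputs, namely the endpoints in real arrays 1 and 2 and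
    the size in natural array 1; copies survive in reserved arrays. *)
Lemma save_intervalsP m n : nmem m 1 0 = n ->
  halts_within save_intervals m (24 * n + 13)
    (fun m' => [/\ nmem m' 3 1 = n, forall x, x != 3%N -> nmem m' x =1 nmem m x,
       forall x, x != 4%N -> x != 5%N -> rmem m' x =1 rmem m x
     & forall j, (j < n)%N ->
         rmem m' 4 j = rmem m 1 j /\ rmem m' 5 j = rmem m 2 j]).
Proof.
move=> mn; pose inv i m' :=
  [/\ forall x, x != 3%N -> nmem m' x =1 nmem m x,
      forall x, x != 4%N -> x != 5%N -> rmem m' x =1 rmem m x
    & forall j, (j < i)%N ->
        rmem m' 4 j = rmem m 1 j /\ rmem m' 5 j = rmem m 2 j].
apply: (halts_within_le (@halts_within_For (NGet 1 (NLit 0)) _ m n inv _ mn _ _ _)) => //.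
- move=> i m1 m2 [nm rm] [a b c]; split=> [x x3 j|x x4 x5 j|j ji].
  + by rewrite nm // a.
  + by rewrite rm b.
  + by rewrite rm; apply: c.
- move=> i m' iltn ci [a b c]; split=> //.
  rewrite /= ci; split=> [|x x4 x5 j|j].
  + exact: a.
  + by rewrite /upd /= (negPf x4) (negPf x5) /= b.
  rewrite ltnS leq_eqVlt /upd /= => /orP[/eqP ->|ji].
    by rewrite eqxx !b.
  by rewrite (ltn_eqF ji); apply: c.
- by move=> /=; lia.
- by move=> m' [[]].
Qed.

(** Tag 0 marks a finite value, 1 stands for [+oo] and anything larger for [-oo], so a nonzero tag
    settles the comparison by itself. *)
Definition if_incl_lt_upper P Q : program :=
  If (BNat (NGet 0 counter) (NLit 1))
    (If (BReal (RGet 0 counter) (RGet 5 counter)) P Q)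
    (If (BNat (NLit 1) (NGet 0 counter)) P Q).

Definition if_lower_lt_excl P Q : program :=
  If (BNat (NGet 1 counter) (NLit 1))
    (If (BReal (RGet 4 counter) (RGet 1 counter)) P Q)
    (If (BNat (NLit 1) (NGet 1 counter)) Q P).

Lemma run_if_incl_lt_upper P Q m i : nmem m 3 0 = i ->
  run (if_incl_lt_upper P Q) m =
  if (Defs.decode (nmem m 0 i) (rmem m 0 i) < (rmem m 5 i)%:E)%E
  then run P m else run Q m.
Proof.
by move=> mi; rewrite /= mi; case: (nmem m 0 i) => [|[|k]] //=; rewrite ltNyr.
Qed.

Lemma run_if_lower_lt_excl P Q m i : nmem m 3 0 = i ->
  run (if_lower_lt_excl P Q) m =
  if ((rmem m 4 i)%:E < Defs.decode (nmem m 1 i) (rmem m 1 i))%E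
  then run P m else run Q m.
Proof.
by move=> mi; rewrite /= mi; case: (nmem m 1 i) => [|[|k]] //=; rewrite ltry.
Qed.

Definition decide_query : program :=
  For bound
    (If (BReal (RGet 3 counter) (RLit 0)) (NSet 0 counter (NLit 1))
       (If (BReal (RGet 4 counter) (RGet 5 counter))
          (if_incl_lt_upper
             (if_lower_lt_excl (NSet 0 counter (NLit 1)) (NSet 0 counter (NLit 0)))
             (NSet 0 counter (NLit 0)))
          (NSet 0 counter (NLit 0)))).

Definition queried m j : bool :=
  (rmem m 3 j < 0) ||
  [&& rmem m 4 j < rmem m 5 j,
      (Defs.decode (nmem m 0 j) (rmem m 0 j) < (rmem m 5 j)%:E)%E
    & ((rmem m 4 j)%:E < Defs.decode (nmem m 1 j) (rmem m 1 j))%E].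

(** The answers replace the tags of the inclusion thresholds in place. This is safe, as round [i]
    reads cell [i] before writing it; hence the clause of [inv] on cells from [i] on. *)
Lemma decide_queryP m n : nmem m 3 1 = n ->
  halts_within decide_query m (60 * n + 13)
    (fun m' => forall j, (j < n)%N -> nmem m' 0 j = queried m j).
Proof.
move=> mn; pose inv i m' :=
  [/\ rmem m' = rmem m, nmem m' 1 =1 nmem m 1,
      forall j, (i <= j)%N -> nmem m' 0 j = nmem m 0 j
    & forall j, (j < i)%N -> nmem m' 0 j = queried m j].
apply: (halts_within_le (@halts_within_For bound _ m n inv _ mn _ _ _)) => //.
- move=> i m1 m2 [nm rm] [a b c d]; split=> [|j|j ij|j ji].
  + by rewrite rm.
  + by rewrite nm // b.
  + by rewrite nm // c.
  + by rewrite nm // d.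
- move=> i m' iltn ci [a b c d].
  pose k : nat := queried m i.
  set body := (X in run X m').
  (* Each branch performs exactly one write to cell [i], so the nested tests amount to a single
     assignment. *)
  suff -> : run body m' = run (NSet 0 counter (NLit k)) m'.
    split=> //; rewrite /= ci; split=> //= [j ij|j].
      by rewrite /upd /= gtn_eqF ?c // ltnW.
    rewrite ltnS leq_eqVlt /upd /= => /orP[/eqP ->|ji]; first by rewrite eqxx.
    by rewrite (ltn_eqF ji) d.
  rewrite {}/body {}/k /queried -b -(c i) // -a.
  rewrite run_If [beval _ _]/= ci; case: ifP => _; first by [].
  rewrite run_If [beval _ _]/= ci; case: ifP => _; last by [].
  rewrite (run_if_incl_lt_upper _ _ ci); case: ifP => _; last by [].
  by rewrite (run_if_lower_lt_excl _ _ ci); case: ifP.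
- by rewrite /=; lia.
- by move=> m' [[]].
Qed.

Definition mix_weights : program :=
  For (NGet 1 (NLit 0))
    (If (BNat (NLit 0) (NGet 2 counter))
       (RSet 1 counter (RGet 3 counter))
       (RSet 1 counter
          (RDiv (RAdd (RGet 1 counter) (RGet 2 counter)) (RLit 2)))).

(** Real array 1 changes from lower endpoints to weights, since the optimization program looks for
    its weights there. Its cells from [n] on must stay zero to match that program's input. *)
Lemma mix_weightsP m n : nmem m 1 0 = n ->
  halts_within mix_weights m (40 * n + 13)
    (fun m' => [/\ forall x, x != 3%N -> nmem m' x =1 nmem m x,
       forall x, x != 1%N -> rmem m' x =1 rmem m x,
       forall j, (n <= j)%N -> rmem m' 1 j = rmem m 1 j
     & forall j, (j < n)%N -> rmem m' 1 j =
         if (0 < nmem m 2 j)%N then rmem m 3 j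
         else (rmem m 1 j + rmem m 2 j) / 2]).
Proof.
move=> mn; pose inv i m' :=
  [/\ forall x, x != 3%N -> nmem m' x =1 nmem m x,
      forall x, x != 1%N -> rmem m' x =1 rmem m x,
      forall j, (i <= j)%N -> rmem m' 1 j = rmem m 1 j
    & forall j, (j < i)%N -> rmem m' 1 j =
        if (0 < nmem m 2 j)%N then rmem m 3 j
        else (rmem m 1 j + rmem m 2 j) / 2].
apply: (halts_within_le (@halts_within_For (NGet 1 (NLit 0)) _ m n inv _ mn _ _ _)) => //.
- move=> i m1 m2 [nm rm] [a b c d]; split=> [x x3 j|x x1 j|j ij|j ji].
  + by rewrite nm // a.
  + by rewrite rm b.
  + by rewrite rm c.
  + by rewrite rm d.
- move=> i m' iltn ci [a b c d].
  set v := if (0 < nmem m 2 i)%N then rmem m 3 i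
           else (rmem m 1 i + rmem m 2 i) / 2.
  set body := (X in run X m').
  suff -> : run body m' = Memory (nmem m') (upd (rmem m') 1 i v).
    split=> //; split=> [|x x1 j|j ij|j] /=.
    + exact: a.
    + by rewrite /upd /= (negPf x1) /= b.
    + by rewrite /upd /= gtn_eqF ?c // ltnW.
    rewrite ltnS leq_eqVlt /upd /= => /orP[/eqP ->|ji]; first by rewrite eqxx.
    by rewrite (ltn_eqF ji) d.
  rewrite /v /= ci a // (b 2%N) // (b 3%N) // c //.
  by case: ifP.
- by rewrite /=; lia.
- by move=> m' [[]].
Qed.

End Programs.

(** * Correctness and running time *)

Lemma nth_codom_ord (T : Type) (x0 : T) n (f : 'I_n -> T) (e : 'I_n) :
  nth x0 (codom f) e = f e.
Proof. by rewrite codomE (nth_map e) ?size_enum_ord // nth_ord_enum. Qed.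

Lemma size_codom_ord (T : Type) n (f : 'I_n -> T) : size (codom f) = n.
Proof. by rewrite size_codom card_ord. Qed.

Lemma nth_load_default (T : Type) (x0 : T) (s : seq (seq T)) x :
  (size s <= x)%N -> nth x0 (nth [::] s x) =1 fun=> x0.
Proof. by move=> sx j; rewrite (nth_default _ sx) nth_nil. Qed.

(** The shifts hide from [P] the loop control, the costs and the saved endpoints, because [P]
    expects every array outside its input to be zero. *)
Definition query_program (P : program) : program :=
  Seq save_intervals (Seq (rename (shift 2 2) (shift 3 3) P) decide_query).

Definition solve_program (P : program) : program :=
  Seq mix_weights (rename (shift 2 2) (shift 2 2) P).

Section Correctness.
Variables (R : realType) (p : problem R) (I : instance p).
Let n := card_of I.
Let F : {set {set 'I_n}} := feasible (system I).
Let U : 'I_n -> set R := ground_intervals I.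
Implicit Types (P : program) (c w : 'I_n -> R).

Lemma query_programP P c T :
  halts_within P (threshold_input I) T
    (outputs_ereals (threshold_incl F U) (threshold_excl F U)) ->
  halts_within (query_program P) (query_input c) (100 * (T + n))
    (outputs_set (optimal_query F (lower I) (upper I) c)).
Proof.
move=> haltsP; have T0 := halts_within_gt0 haltsP.
have save := @save_intervalsP R (query_input c) n erefl.
(* The constant 26 is absorbed by the multiple of [T], as [T] is positive. *)
pose T' := (24 * n + 13 + (T + (60 * n + 13)))%N.
apply: (@halts_within_le _ _ _ T' _
  (outputs_set (optimal_query F (lower I) (upper I) c))) => //; last by lia.
apply: halts_within_Seq save _ => m1 [m1n nm1 rm1 savedI].
(* Through the shifts, [P] sees its own input in place and zeros everywhere else. *)
have rep1 : represents (shift 2 2) (shift 3 3) (threshold_input I) m1.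
  split=> x; rewrite /shift; case: ltnP => x_lt j.
  - by rewrite nm1; [case: x x_lt => [|[|]]|lia].
  - rewrite nm1; last by lia.
    by rewrite /= !nth_load_default //=; lia.
  - rewrite rm1; try by lia.
    by case: x x_lt => [|[|[|]]].
  - rewrite rm1; try by lia.
    by rewrite /= !nth_load_default //=; lia.
apply: halts_within_Seq
  (halts_within_rename (@shift_inj 2 2) (@shift_inj 3 3) rep1 haltsP) _.
move=> m2 [[nm2 rm2] [m [nm rm] out]].
have m2n : nmem m2 3 1 = n by rewrite (nm2 3%N) //; apply: shift_reserved.
apply: halts_within_le (decide_queryP m2n) (leqnn _) _ => m3 m3E e.
rewrite (m3E e (ltn_ord e)) inE /queried; congr (nat_of_bool _).
have [tI tX] := out e.
rewrite (nm 0%N) (nm 1%N) (rm 0%N) (rm 1%N) tI tX.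
have [m1l m1u] := savedI e (ltn_ord e).
have res x : (3 <= x < 6)%N -> rmem m2 x e = rmem m1 x e.
  by move=> xP; apply: rm2; apply: shift_reserved.
rewrite !res // rm1 // m1l m1u /= !nth_codom_ord.
by rewrite /mandatory.
Qed.

Lemma solve_programP P (Q S : {set 'I_n}) w T :
  halts_within P
    (@optimization_input R p (system I) (midpoint (lower I) (upper I) Q w)) T
    (outputs_set S) ->
  halts_within (solve_program P) (solution_input Q w) (100 * (T + n))
    (outputs_set S).
Proof.
move=> haltsP; have T0 := halts_within_gt0 haltsP.
have mix := @mix_weightsP R (solution_input Q w) n erefl.
pose T' := (40 * n + 13 + T)%N.
apply: (@halts_within_le _ _ _ T' _ (outputs_set S)) => //; last by lia.
apply: halts_within_Seq mix _ => m1 [nm1 rm1 beyond mixed].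
have rep1 : represents (shift 2 2) (shift 2 2)
    (@optimization_input R p (system I) (midpoint (lower I) (upper I) Q w)) m1.
  split=> x; rewrite /shift; case: ltnP => x_lt j.
  - by rewrite nm1; [case: x x_lt => [|[|]]|lia].
  - rewrite nm1; last by lia.
    by rewrite /= !nth_load_default //=; lia.
  - case: x x_lt => [|[|//]] _; first by rewrite rm1.
    (* From [n] on, both arrays consist of the default value 0. *)
    have [jn|nj] := ltnP j n; last first.
      by rewrite beyond //= !nth_default // size_codom_ord.
    rewrite mixed //= -[j]/(nat_of_ord (Ordinal jn)) !nth_codom_ord.
    by rewrite /midpoint; case: (_ \in Q).
  - rewrite rm1; last by lia.
    by rewrite /= !nth_load_default //=; lia.
apply: halts_within_le
  (halts_within_rename (@shift_inj 2 2) (@shift_inj 2 2) rep1 haltsP) (leqnn _) _.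
by move=> m2 [_ [m [nm _] out]] e; rewrite (nm 0%N) out.
Qed.

End Correctness.

Theorem theorem3p6 (R : realType) :
  exists C : nat,
  forall (p : problem R) (K : set (instance p))
    (T_THR : instance p -> nat) (T_OPT : desc p -> nat),
  thresholds_computable_in K T_THR ->
  optimization_computable_in K T_OPT ->
  exists Pquery Psolve : program,
  forall I : instance p, K I ->
  forall c : 'I_(card_of I) -> R,
  exists Q : {set 'I_(card_of I)},
    [/\ min_cost_admissible (feasible (system I)) c (ground_intervals I) Q,
        halts_within Pquery (query_input c)
          (C * (T_THR I + card_of I))%N (outputs_set Q)
      & forall w : 'I_(card_of I) -> R,
        (forall e, e \in Q -> ground_intervals I e (w e)) ->
        exists S : {set 'I_(card_of I)},
          universally_optimal (feasible (system I))
            (reveal Q w (ground_intervals I)) S /\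
          halts_within Psolve (solution_input Q w)
            (C * (T_OPT (system I) + card_of I))%N (outputs_set S)].
Proof.
exists 100%N => p K T_THR T_OPT [Pthr thrP] [Popt optP].
exists (query_program Pthr), (solve_program Popt) => I KI c.
have F0 := feasible_neq0 (system I); have lu := lower_le_upper (i := I).
exists (optimal_query (feasible (system I)) (lower I) (upper I) c); split.
- exact: optimal_query_min_cost.
- exact: query_programP (thrP I KI).
move=> w wU.
(* Whichever optimum the program returns for the midpoint weights is universally optimal, so a
   single call suffices. *)
have [S [Smin Shalts]] := optP I KI (midpoint (lower I) (upper I)
  (optimal_query (feasible (system I)) (lower I) (upper I) c) w).
exists S; split; last exact: solve_programP Shalts.
by apply: midpoint_universally_optimal => // e Me; rewrite inE Me orbT.
Qed.
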